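(* Let $\mathbf{A}$ be a finite algebra with a Mal'cev term. Then: (1) If $\mathbf{A}$ is not nilpotent, then its congruence lattice $\mathrm{Con}(\mathbf{A})$ splits. (2) If $\mathrm{Con}(\mathbf{A})$ does not split strongly, then there exist $n\in\mathbb{N}_0$ and algebras $\mathbf{B},\mathbf{C}_1,\ldots,\mathbf{C}_n$ such that $\mathbf{A}$ is isomorphic to the direct product $\mathbf{B}\times\mathbf{C}_1\times\cdots\times\mathbf{C}_n$, $\mathbf{B}$ is nilpotent, each $\mathbf{C}_i$ is simple, and the direct product is skew-free.
   Context: Algebras are universal algebras; $\mathbb{N}_0$ is the set of nonnegative integers. A Mal'cev term is a ternary term $d$ with $d(x,x,y)=y=d(y,x,x)$ identically. $0$ and $1$ denote the least and greatest element of a lattice (in particular of $\mathrm{Con}(\mathbf{A})$). Splitting. Let $\mathbb{L}$ be a complete lattice and $\delta,\varepsilon\in\mathbb{L}$. The pair $(\delta,\varepsilon)$ is a splitting pair of $\mathbb{L}$ if $\delta<1$, $\varepsilon>0$, and for all $\alpha\in\mathbb{L}$ we have $\alpha\ge\varepsilon$ or $\alpha\le\delta$. It is strong if $\delta\ge\varepsilon$. $\mathbb{L}$ splits if it has a splitting pair, and splits strongly if it has a strong splitting pair. Commutator and nilpotency. For congruences $\alpha,\beta$ of $\mathbf{A}$, the (binary term condition) commutator $[\alpha,\beta]_{\mathbf{A}}$ is the smallest congruence $\eta$ of $\mathbf{A}$ such that for every polynomial operation $f$ of $\mathbf{A}$ (with its variables divided into two blocks) and all tuples $\mathbf{a}_1,\mathbf{b}_1$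 that are componentwise congruent modulo $\alpha$ and $\mathbf{a}_2,\mathbf{b}_2$ that are componentwise congruent modulo $\beta$: if $f(\mathbf{a}_1,\mathbf{a}_2)\equiv_\eta f(\mathbf{a}_1,\mathbf{b}_2)$, then $f(\mathbf{b}_1,\mathbf{a}_2)\equiv_\eta f(\mathbf{b}_1,\mathbf{b}_2)$. An algebra $\mathbf{A}$ with a Mal'cev term is nilpotent if and only if its lower central series defined by $\gamma_1:=1$, $\gamma_n:=[1,\gamma_{n-1}]_{\mathbf{A}}$ for $n\ge2$ reaches $0$ after finitely many steps. Skew-free. A direct product $\mathbf{B}=\mathbf{A}_1\times\cdots\times\mathbf{A}_n$ is skew-free if for every congruence $\beta$ of $\mathbf{B}$ there are congruences $\alpha_1\in\mathrm{Con}(\mathbf{A}_1),\ldots,\alpha_n\in\mathrm{Con}(\mathbf{A}_n)$ such that for all $(a_1,\ldots,a_n),(b_1,\ldots,b_n)\in B$ we have $((a_1,\ldots,a_n),(b_1,\ldots,b_n))\in\beta$ if and only if $(a_i,b_i)\in\alpha_i$ for all $i\in\{1,\ldots,n\}$. *)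

(* Defs.v *)
From HB Require Import structures.
From mathcomp Require Import all_boot all_order.
From mathcomp Require Import boolp.

Set Implicit Arguments.
Unset Strict Implicit.
Unset Printing Implicit Defensive.

Import Order.TTheory.
Local Open Scope order_scope.

Record signature := Signature { symb : Type; arity : symb -> nat }.

(* Carriers are nonempty, as usual in universal algebra; the signature may be
   infinite and may contain nullary symbols. *)
Record finalgebra (S : signature) := FinAlgebra {
  carrier :> finType;
  carrier_gt0 : (0 < #|carrier|)%N;
  op : forall f : symb S, {ffun 'I_(arity f) -> carrier} -> carrier }.
Arguments op {S} A f a : rename.

Inductive term (S : signature) (X : Type) :=
  | Var (x : X)
  | App (f : symb S) (t : 'I_(arity f) -> term S X).

Fixpoint eval (S : signature) (A : finalgebra S) (X : Type) (v : X -> A)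
    (t : term S X) : A :=
  match t with
  | Var x => v x
  | App f ts => op A f [ffun i => eval v (ts i)]
  end.

(* Polynomials are terms in variables X and constants from A; polynomial
   operations are exactly the functions [peval ^~ p]. *)
Definition polynomial (S : signature) (A : finalgebra S) (X : Type) :=
  term S (X + A).

Definition peval (S : signature) (A : finalgebra S) (X : Type) (v : X -> A)
    (p : polynomial A X) : A :=
  eval (fun z => match z with inl x => v x | inr c => c end) p.

Definition has_malcev_term (S : signature) (A : finalgebra S) : Prop :=
  exists d : term S 'I_3, forall x y : A,
    eval (tnth [tuple x; x; y]) d = y /\ eval (tnth [tuple y; x; x]) d = y.

Definition compatible (S : signature) (A : finalgebra S) (r : rel A) : Prop :=
  forall (f : symb S) (a b : {ffun 'I_(arity f) -> A}),
    (forall i, r (a i) (b i)) -> r (op A f a) (op A f b).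

Definition congruence (S : signature) (A : finalgebra S) (r : rel A) : Prop :=
  [/\ reflexive r, symmetric r, transitive r & compatible r].

(* [asbool] is needed because compatibility quantifies over all symbols. *)
Record con (S : signature) (A : finalgebra S) := Con {
  con_set : {set A * A};
  con_setP : `[< congruence (fun x y => (x, y) \in con_set) >] }.

HB.instance Definition _ (S : signature) (A : finalgebra S) :=
  [isSub for @con_set S A].
HB.instance Definition _ (S : signature) (A : finalgebra S) :=
  [Finite of con A by <:].

Definition con_rel (S : signature) (A : finalgebra S) (alpha : con A) : rel A :=
  fun x y => (x, y) \in con_set alpha.
Coercion con_rel : con >-> rel.

Lemma con_congruence (S : signature) (A : finalgebra S) (alpha : con A) :
  congruence alpha.
Proof. by case: alpha => R RP; apply/asboolP. Qed.

Section ConLattice.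
Variables (S : signature) (A : finalgebra S).
Implicit Types alpha beta gamma : con A.

Lemma con_inf_subproof (P : pred (con A)) :
  `[< congruence (fun x y : A =>
        (x, y) \in [set p | [forall alpha, P alpha ==> alpha p.1 p.2]]) >].
Proof.
apply/asboolP; split=> [x|x y|y x z|f a b ab]; rewrite ?inE.
- by apply/'forall_implyP => al _; case: (con_congruence al).
- by apply: eq_forallb => al /=; case: (con_congruence al) => _ -> _ _.
- move=> /'forall_implyP xy /'forall_implyP yz; apply/'forall_implyP => al Pal.
  by case: (con_congruence al) => _ _ tr _; apply: tr (xy _ Pal) (yz _ Pal).
- apply/'forall_implyP => al Pal; case: (con_congruence al) => _ _ _; apply=> i.
  by move: (ab i); rewrite inE => /'forall_implyP; apply.
Qed.

Definition con_inf (P : pred (con A)) : con A := Con (con_inf_subproof P).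

Lemma con_infE (P : pred (con A)) x y :
  con_inf P x y = [forall alpha, P alpha ==> alpha x y].
Proof. by rewrite /con_rel inE. Qed.

Definition con_le alpha beta := con_set alpha \subset con_set beta.

Lemma con_leP alpha beta :
  reflect (forall x y, alpha x y -> beta x y) (con_le alpha beta).
Proof.
by apply: (iffP subsetP) => [ab x y|ab [x y]]; [apply: ab|apply: (ab x y)].
Qed.

Lemma con_le_refl : reflexive con_le.
Proof. by move=> al; apply: subxx. Qed.

Lemma con_le_anti : antisymmetric con_le.
Proof. by move=> al be; rewrite /con_le -eqEsubset => /eqP/val_inj. Qed.

Lemma con_le_trans : transitive con_le.
Proof. by move=> al be ga; apply: subset_trans. Qed.

Fact con_display : Order.disp_t. Proof. exact: (Order.Disp tt tt). Qed.

HB.instance Definition _ := Order.Le_isPOrder.Build con_display (con A)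
  con_le_refl con_le_anti con_le_trans.

Definition con_meet alpha beta := con_inf (pred2 alpha beta).
Definition con_join alpha beta :=
  con_inf [pred gamma | (alpha <= gamma) && (beta <= gamma)].

Lemma con_lexI alpha beta gamma :
  (alpha <= con_meet beta gamma) = (alpha <= beta) && (alpha <= gamma).
Proof.
apply/con_leP/andP => [le|[/con_leP lb /con_leP lg] x y xy].
  by split; apply/con_leP => x y /le; rewrite con_infE => /'forall_implyP;
    apply; rewrite /= eqxx ?orbT.
rewrite con_infE; apply/'forall_implyP => de /pred2P[]->; [exact: lb|exact: lg].
Qed.

Lemma con_leUx alpha beta gamma :
  (con_join alpha beta <= gamma) = (alpha <= gamma) && (beta <= gamma).
Proof.
apply/con_leP/andP => [le|[ag bg] x y].
  by split; apply/con_leP => x y xy; apply: le; rewrite con_infE;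
    apply/'forall_implyP => de /andP[/con_leP ad /con_leP bd]; auto.
by rewrite con_infE => /'forall_implyP; apply; rewrite /= ag bg.
Qed.

HB.instance Definition _ := Order.POrder_MeetJoin_isLattice.Build con_display
  (con A) con_lexI con_leUx.

Lemma con_bot_subproof :
  `[< congruence (fun x y : A => (x, y) \in [set p | p.1 == p.2]) >].
Proof.
apply/asboolP; split=> [x|x y|y x z|f a b ab]; rewrite !inE /=.
- exact: eqxx.
- exact: eq_sym.
- by move=> /eqP->.
- suff -> : a = b by [].
  by apply/ffunP => i; move: (ab i); rewrite inE => /eqP.
Qed.

Lemma con_top_subproof :
  `[< congruence (fun x y : A => (x, y) \in [set: A * A]) >].
Proof. by apply/asboolP; split; do ?move=> ?; rewrite ?inE. Qed.

Lemma con_le0x alpha : Con con_bot_subproof <= alpha.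
Proof.
apply/con_leP => x y; rewrite /con_rel inE /= => /eqP->.
by case: (con_congruence alpha) => + _ _ _; apply.
Qed.

Lemma con_lex1 alpha : alpha <= Con con_top_subproof.
Proof. exact: subsetT. Qed.

HB.instance Definition _ :=
  Order.hasBottom.Build con_display (con A) con_le0x.
HB.instance Definition _ :=
  Order.hasTop.Build con_display (con A) con_lex1.

Lemma con_le_relP alpha beta :
  reflect (forall x y, alpha x y -> beta x y) (alpha <= beta).
Proof. exact: con_leP. Qed.

Lemma con_botE x y : (\bot : con A) x y = (x == y).
Proof. by rewrite /con_rel inE. Qed.

Lemma con_topE x y : (\top : con A) x y.
Proof. by rewrite /con_rel inE. Qed.

End ConLattice.

(* There is no structure of complete lattices; only the order and the bounds
   matter here, and [con A] is complete because it is finite. *)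
Definition splitting_pair d (L : tbLatticeType d) (delta epsilon : L) : Prop :=
  [/\ delta < \top, \bot < epsilon
    & forall alpha : L, epsilon <= alpha \/ alpha <= delta].

Definition strong_splitting_pair d (L : tbLatticeType d) (delta epsilon : L) :
    Prop :=
  splitting_pair delta epsilon /\ epsilon <= delta.

Definition splits d (L : tbLatticeType d) : Prop :=
  exists delta epsilon : L, splitting_pair delta epsilon.

Definition splits_strongly d (L : tbLatticeType d) : Prop :=
  exists delta epsilon : L, strong_splitting_pair delta epsilon.

Definition join_blocks (T : Type) (m n : nat) (a : 'I_m -> T) (b : 'I_n -> T)
    (z : 'I_m + 'I_n) : T :=
  match z with inl i => a i | inr j => b j end.

Definition term_condition (S : signature) (A : finalgebra S)
    (alpha beta eta : con A) : Prop :=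
  forall (m n : nat) (f : polynomial A ('I_m + 'I_n))
         (a1 b1 : 'I_m -> A) (a2 b2 : 'I_n -> A),
    (forall i, alpha (a1 i) (b1 i)) -> (forall j, beta (a2 j) (b2 j)) ->
    eta (peval (join_blocks a1 a2) f) (peval (join_blocks a1 b2) f) ->
    eta (peval (join_blocks b1 a2) f) (peval (join_blocks b1 b2) f).

Definition commutator (S : signature) (A : finalgebra S) (alpha beta : con A) :
    con A :=
  \meet_(eta : con A | `[< term_condition alpha beta eta >]) eta.

Lemma commutator_term_condition (S : signature) (A : finalgebra S)
  (alpha beta : con A) : term_condition alpha beta (commutator alpha beta).
Proof.
rewrite /commutator; elim/big_ind: _ => [|eta eta' IH IH'|eta /asboolP//].
  by move=> m n f *; apply: con_topE.
have meetE x y : (eta `&` eta' : con A) x y = eta x y && eta' x y.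
  rewrite [LHS]con_infE; apply/'forall_implyP/andP => [h|[h h'] _ /pred2P[]->//].
  by split; apply: h; rewrite /= eqxx ?orbT.
move=> m n f a1 b1 a2 b2 h1 h2; rewrite !meetE => /andP[h h'].
by apply/andP; split; [apply: (IH _ _ _ a1)|apply: (IH' _ _ _ a1)].
Qed.

Lemma commutator_least (S : signature) (A : finalgebra S)
  (alpha beta eta : con A) :
  term_condition alpha beta eta -> commutator alpha beta <= eta.
Proof. by move=> h; apply: meets_inf; apply/asboolP. Qed.

(* Indexed from 0: [lower_central A n] is $\gamma_{n+1}$. *)
Fixpoint lower_central (S : signature) (A : finalgebra S) (n : nat) : con A :=
  if n is n'.+1 then commutator \top (lower_central A n') else \top.

Definition nilpotent (S : signature) (A : finalgebra S) : Prop :=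
  exists n, lower_central A n = \bot.

Definition simple (S : signature) (A : finalgebra S) : Prop :=
  (\bot : con A) <> \top /\
  forall alpha : con A, alpha = \bot \/ alpha = \top.

Definition isomorphic (S : signature) (A B : finalgebra S) : Prop :=
  exists2 h : A -> B, bijective h
    & forall (f : symb S) (a : {ffun 'I_(arity f) -> A}),
        h (op A f a) = op B f [ffun i => h (a i)].

Lemma dprod_gt0 (S : signature) (n : nat) (D : 'I_n -> finalgebra S) :
  (0 < #|{dffun forall i : 'I_n, D i}|)%N.
Proof.
have pt i : D i by have /card_gt0P/sigW[x _] := carrier_gt0 (D i).
by apply/card_gt0P; exists (finfun pt : {dffun forall i : 'I_n, D i}).
Qed.

Definition dprod (S : signature) (n : nat) (D : 'I_n -> finalgebra S) :
    finalgebra S :=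
  @FinAlgebra S {dffun forall i : 'I_n, D i} (dprod_gt0 D)
    (fun f a => finfun (fun i => op (D i) f [ffun k => a k i])).

Definition skew_free (S : signature) (n : nat) (D : 'I_n -> finalgebra S) :
    Prop :=
  forall beta : con (dprod D), exists alpha : forall i, con (D i),
    forall a b : dprod D,
      beta a b <-> forall i, alpha i ((a : {dffun _}) i) ((b : {dffun _}) i).

Definition cons_family (T : Type) (n : nat) (B : T) (C : 'I_n -> T)
    (i : 'I_n.+1) : T :=
  if unlift ord0 i is Some j then C j else B.

(* Main.v *)
Require Import Defs.
From mathcomp Require Import all_boot all_order.
From mathcomp Require Import boolp.

(** In an algebra with a Mal'cev term congruences permute, and the term
    condition commutator is symmetric and distributes over joins
    ([commutatorC], [commutatorUl], [commutatorUr]). These facts alone drive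
    the argument; write G for the operator [commutator \top].

    Let rho be a congruence above no term of the lower central series, and
    choose epsilon minimal among the congruences none of whose iterates under G
    falls below rho. Minimality makes G epsilon = epsilon. Since the iterates
    of G distribute over joins, the join of two congruences strictly below
    epsilon still has an iterate below rho, so epsilon is join irreducible.
    Every alpha that is not above epsilon satisfies [alpha, epsilon] < epsilon,
    hence so does the join delta of all these alpha; as [1, epsilon] = epsilon,
    delta is not 1, and (delta, epsilon) is a splitting pair
    ([nonnilpotent_splitting_pair]). For rho = 0 this is the first claim.

    If the lattice does not split strongly, then delta and epsilon are
    complements and delta is a coatom ([not_splits_strongly_complements]):
    otherwise (delta, delta /\ epsilon) or (delta \/ epsilon, epsilon) would be
    a strong splitting pair. Moreover every congruence beta is the meet of
    beta \/ epsilon and beta \/ delta ([splitting_distr]). Replacing rho by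
    rho \/ epsilon and repeating, starting from 0, collects coatoms
    delta_1, ..., delta_n until rho has become a congruence tau with nilpotent
    quotient ([coatom_decomposition], [quot_nilpotent]). Every congruence beta
    is then the meet of its joins with tau, delta_1, ..., delta_n, and any
    system of congruences x = a_i modulo these is solvable. Thus A is the
    product of the corresponding quotients and the product is skew-free
    ([diag_isomorphic], [quots_skew_free]). *)

Set Implicit Arguments.
Unset Strict Implicit.
Unset Printing Implicit Defensive.

Import Order.TTheory.
Local Open Scope order_scope.

(** * Lattices that do not split strongly *)

(** In each case a failure enlarges delta, or shrinks epsilon, to a strong
    splitting pair; and an element strictly above delta is above epsilon, hence
    above their join. *)
Lemma not_splits_strongly_complements dsp (L : tbLatticeType dsp)
    (delta epsilon : L) :
  ~ splits_strongly L -> splitting_pair delta epsilon ->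
  [/\ delta `&` epsilon = \bot, delta `|` epsilon = \top
    & forall alpha, delta < alpha -> alpha = \top].
Proof.
move=> nss [d1 e0 sp].
have top : delta `|` epsilon = \top.
  apply/eqP/negPn/negP; rewrite -ltx1 => lt; apply: nss.
  exists (delta `|` epsilon), epsilon; split; last exact: leUr.
  split=> // alpha; case: (sp alpha) => h; [by left|right].
  exact: lexUl.
split=> //.
  apply/eqP/negPn/negP; rewrite -lt0x => lt; apply: nss.
  exists delta, (delta `&` epsilon); split; last exact: leIl.
  split=> // alpha; case: (sp alpha) => h; [left|by right].
  exact: leIxr.
move=> alpha lt; apply/eqP; rewrite -le1x -top leUx ltW //=.
by case: (sp alpha) => // /(lt_le_trans lt); rewrite ltxx.
Qed.

(** * Congruences and homomorphisms *)

Section Congruences.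
Variables (S : signature) (A : finalgebra S).
Implicit Types (alpha beta : con A) (x y z : A).

Lemma con_refl alpha x : alpha x x.
Proof. by case: (con_congruence alpha). Qed.

Lemma con_sym alpha x y : alpha x y -> alpha y x.
Proof. by case: (con_congruence alpha) => _ ->. Qed.

Lemma con_trans alpha y x z : alpha x y -> alpha y z -> alpha x z.
Proof. by case: (con_congruence alpha) => _ _ tr _; apply: tr. Qed.

Lemma con_op alpha (f : symb S) (a b : {ffun 'I_(arity f) -> A}) :
  (forall i, alpha (a i) (b i)) -> alpha (op A f a) (op A f b).
Proof. by case: (con_congruence alpha) => _ _ _; apply. Qed.

Lemma con_eval alpha (X : Type) (v w : X -> A) (t : term S X) :
  (forall i, alpha (v i) (w i)) -> alpha (eval v t) (eval w t).
Proof.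
move=> vw; elim: t => [x|f ts IH] /=; first exact: vw.
by apply: con_op => i; rewrite !ffunE.
Qed.

Lemma con_peval alpha (X : Type) (v w : X -> A) (p : polynomial A X) :
  (forall i, alpha (v i) (w i)) -> alpha (peval v p) (peval w p).
Proof. by move=> vw; apply: con_eval => -[x|c] //; apply: con_refl. Qed.

Lemma con_of_subproof (r : rel A) : congruence r ->
  `[< congruence (fun x y => (x, y) \in [set p : A * A | r p.1 p.2]) >].
Proof.
case=> r1 r2 r3 r4; apply/asboolP; split=> [x|x y|y x z|f a b ab].
- by rewrite inE.
- by rewrite !inE.
- by rewrite !inE; apply: r3.
- by rewrite inE; apply: r4 => i; have:= ab i; rewrite inE.
Qed.

Definition con_of (r : rel A) (rP : congruence r) : con A :=
  Con (con_of_subproof rP).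

Lemma con_ofE (r : rel A) (rP : congruence r) x y : con_of rP x y = r x y.
Proof. by rewrite /con_rel inE. Qed.

Lemma con_ext alpha beta : (forall x y, alpha x y <-> beta x y) ->
  alpha = beta.
Proof.
by move=> ab; apply: le_anti; apply/andP; split; apply/con_le_relP => x y /ab.
Qed.

Lemma con_lt_card alpha beta : alpha < beta ->
  (#|con_set alpha| < #|con_set beta|)%N.
Proof.
rewrite lt_neqAle => /andP[ne le]; apply: proper_card.
by rewrite properEneq; apply/andP.
Qed.

Lemma con_meetE alpha beta x y :
  (alpha `&` beta : con A) x y = alpha x y && beta x y.
Proof.
rewrite [LHS]con_infE; apply/'forall_implyP/andP => [h|[h h'] _ /pred2P[]->//].
by split; apply: h; rewrite /= eqxx ?orbT.
Qed.

End Congruences.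

Lemma eval_hom (S : signature) (A B : finalgebra S) (h : A -> B)
    (hom : forall f a, h (op A f a) = op B f [ffun i => h (a i)])
    (X : Type) (v : X -> A) (t : term S X) :
  eval (fun x => h (v x)) t = h (eval v t).
Proof.
elim: t => [//|f ts IH] /=; rewrite hom; congr op; apply/ffunP => i.
by rewrite !ffunE IH.
Qed.

Section Pullback.
Variables (S : signature) (A B : finalgebra S) (h : A -> B).
Hypothesis hom : forall f a, h (op A f a) = op B f [ffun i => h (a i)].
Variable beta : con B.

Lemma pullback_subproof : congruence (fun x y => beta (h x) (h y)).
Proof.
split=> [x|x y|y x z|f a b ab]; first exact: con_refl.
- by apply/idP/idP; apply: con_sym.
- exact: con_trans.
- by rewrite !hom; apply: con_op => i; rewrite !ffunE.
Qed.

Definition pullback : con A := con_of pullback_subproof.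

Lemma pullbackE x y : pullback x y = beta (h x) (h y).
Proof. exact: con_ofE. Qed.

End Pullback.

(** * Quotient algebras *)

Section Quotient.
Variables (S : signature) (A : finalgebra S) (theta : con A).

Definition canon (x : A) : A := odflt x [pick y | theta x y].

Lemma canonP x : theta x (canon x).
Proof. by rewrite /canon; case: pickP => //= _; apply: con_refl. Qed.

Lemma canon_eq x y : theta x y -> canon x = canon y.
Proof.
move=> xy; rewrite /canon.
have E z : theta x z = theta y z.
  by apply/idP/idP; apply: con_trans; [apply: con_sym|].
rewrite (eq_pick E); case: pickP => //= /(_ y); by rewrite con_refl.
Qed.

(** Quotients are carried by canonical representatives of the classes: this
    gives a finite type with an explicit section [rep] of the projection. *)
Definition quot_carrier : finType := {x : A | canon x == x}.

Lemma canon_canon x : canon (canon x) == canon x.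
Proof. by apply/eqP/canon_eq/con_sym/canonP. Qed.

Definition class_of (x : A) : quot_carrier := exist _ (canon x) (canon_canon x).

Definition rep (u : quot_carrier) : A := sval u.

Lemma rep_inj : injective rep.
Proof. exact: val_inj. Qed.

Lemma quot_gt0 : (0 < #|quot_carrier|)%N.
Proof.
have /card_gt0P/sigW[x _] := carrier_gt0 A.
by apply/card_gt0P; exists (class_of x).
Qed.

Definition quot : finalgebra S :=
  @FinAlgebra S quot_carrier quot_gt0
    (fun f a => class_of (op A f [ffun i => rep (a i)])).

(** The projection, typed so that the algebra is inferred from its codomain. *)
Definition proj : A -> quot := class_of.

Lemma rep_projP x : theta x (rep (proj x)).
Proof. exact: canonP. Qed.

Lemma proj_eqP x y : proj x = proj y <-> theta x y.
Proof.
split=> [e|xy]; last by apply: rep_inj; apply: canon_eq.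
by apply: con_trans (rep_projP x) _; rewrite e; apply/con_sym/rep_projP.
Qed.

Lemma proj_rep (u : quot) : proj (rep u) = u.
Proof. by apply: rep_inj; apply/eqP/(svalP u). Qed.

Lemma proj_hom f a : proj (op A f a) = op quot f [ffun i => proj (a i)].
Proof.
apply/proj_eqP/con_op => i; rewrite !ffunE; exact: rep_projP.
Qed.

Section Image.
Variable eta : con A.
Hypothesis theta_eta : theta <= eta.

Lemma quot_con_subproof :
  congruence (fun u v : quot => eta (rep u) (rep v)).
Proof.
have le := con_le_relP _ _ theta_eta.
split=> [x|x y|y x z|f a b ab]; first exact: con_refl.
- by apply/idP/idP; apply: con_sym.
- exact: con_trans.
- apply: (con_trans (y := op A f [ffun i => rep (a i)])).
    by apply/con_sym/le/rep_projP.
  apply: con_trans (le _ _ (rep_projP _)).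
  by apply: con_op => i; rewrite !ffunE.
Qed.

Definition quot_con : con quot := con_of quot_con_subproof.

Lemma quot_con_proj x y : quot_con (proj x) (proj y) = eta x y.
Proof.
have le z := con_le_relP _ _ theta_eta _ _ (rep_projP z).
rewrite /quot_con con_ofE; apply/idP/idP => h.
  exact: con_trans (le x) (con_trans h (con_sym (le y))).
exact: con_trans (con_sym (le x)) (con_trans h (le y)).
Qed.

End Image.

(** Pulling a congruence of the quotient back along the projection gives a
    congruence above theta, for which only theta and the top are left. *)
Lemma quot_simple : theta < \top ->
  (forall alpha, theta < alpha -> alpha = \top) -> simple quot.
Proof.
move=> lt1 coatom; split=> [e|alpha].
  move: lt1; rewrite lt_neqAle => /andP[/eqP + _]; apply.
  apply: con_ext => x y; split=> _; first exact: con_topE.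
  have : (\bot : con quot) (proj x) (proj y) by rewrite e con_topE.
  by rewrite con_botE => /eqP/proj_eqP.
pose beta := pullback proj_hom alpha.
have le : theta <= beta.
  apply/con_le_relP => x y /proj_eqP e.
  by rewrite pullbackE e con_refl.
have [e|ne] := eqVneq theta beta; [left|right].
  apply: con_ext => u v; rewrite con_botE; split=> [uv|/eqP->]; last first.
    exact: con_refl.
  apply/eqP; rewrite -(proj_rep u) -(proj_rep v); apply/proj_eqP.
  by rewrite e pullbackE !proj_rep.
have e : beta = \top by apply: coatom; rewrite lt_neqAle ne.
apply: con_ext => u v; split=> _; first exact: con_topE.
by rewrite -(proj_rep u) -(proj_rep v) -(pullbackE proj_hom) -/beta e con_topE.
Qed.

End Quotient.

(** * Polynomial operations *)

Section PolynomialOperations.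
Variables (S : signature) (A : finalgebra S).

Fixpoint subst (X Y : Type) (s : X -> term S Y) (t : term S X) : term S Y :=
  match t with
  | Var x => s x
  | App f ts => App (fun i => subst s (ts i))
  end.

Lemma eval_subst (X Y : Type) (s : X -> term S Y) (v : Y -> A) (t : term S X) :
  eval v (subst s t) = eval (fun x => eval v (s x)) t.
Proof.
by elim: t => [//|f ts IH] /=; congr op; apply/ffunP => i; rewrite !ffunE.
Qed.

Lemma eq_eval (X : Type) (v w : X -> A) (t : term S X) :
  v =1 w -> eval v t = eval w t.
Proof. by move=> /funext->. Qed.

(** Working with functions that are realized by some polynomial, rather than
    with polynomials themselves, hides the substitutions behind the two closure
    lemmas below. *)
Definition polyop (X : Type) (F : (X -> A) -> A) : Prop :=
  exists p : polynomial A X, forall v, peval v p = F v.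

(** The map s renames some variables and replaces the others by constants. *)
Lemma polyop_fix (X Y : Type) (s : X -> Y + A) (F : (X -> A) -> A) :
  polyop F ->
  polyop (fun v => F (fun x => match s x with inl y => v y | inr c => c end)).
Proof.
move=> [p pF]; exists (subst (fun z => match z with
  | inl x => Var S (s x) | inr c => Var S (inr c) end) p) => v.
rewrite -pF /peval eval_subst; apply: eq_eval => -[x|c] //=.
Qed.

Lemma polyop_term (X : Type) (F G H : (X -> A) -> A) (d : term S 'I_3) :
  polyop F -> polyop G -> polyop H ->
  polyop (fun v => eval (tnth [tuple F v; G v; H v]) d).
Proof.
move=> [p pF] [q qG] [r rH]; exists (subst (tnth [tuple p; q; r]) d) => v.
rewrite /peval eval_subst; apply: eq_eval => i.
by rewrite -pF -qG -rH; case: i => -[|[|[|]]] //.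
Qed.

Lemma term_condition_polyop (m n : nat) (alpha beta eta : con A)
    (F : ('I_m + 'I_n -> A) -> A) (a1 b1 : 'I_m -> A) (a2 b2 : 'I_n -> A) :
  term_condition alpha beta eta -> polyop F ->
  (forall i, alpha (a1 i) (b1 i)) -> (forall j, beta (a2 j) (b2 j)) ->
  eta (F (join_blocks a1 a2)) (F (join_blocks a1 b2)) ->
  eta (F (join_blocks b1 a2)) (F (join_blocks b1 b2)).
Proof. by move=> C [p pF] h1 h2; rewrite -!pF; apply: C. Qed.

End PolynomialOperations.

(** * The commutator in the presence of a Mal'cev term *)

Section Commutator.
Variables (S : signature) (A : finalgebra S).
Implicit Types alpha beta gamma eta : con A.

Lemma commutator_ler alpha beta : commutator alpha beta <= beta.
Proof.
apply: commutator_least => m n f a1 b1 a2 b2 _ h2 _.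
by apply: con_peval => -[i|j] //=; apply: con_refl.
Qed.

Lemma commutator_lel alpha beta : commutator alpha beta <= alpha.
Proof.
apply: commutator_least => m n f a1 b1 a2 b2 h1 _ h.
have h' c2 : alpha (peval (join_blocks a1 c2) f) (peval (join_blocks b1 c2) f).
  by apply: con_peval => -[i|j] //=; apply: con_refl.
exact: con_trans (con_sym (h' _)) (con_trans h (h' _)).
Qed.

Lemma term_condition_mono alpha alpha' beta beta' eta :
  alpha' <= alpha -> beta' <= beta ->
  term_condition alpha beta eta -> term_condition alpha' beta' eta.
Proof.
move=> /con_le_relP la /con_le_relP lb C m n f a1 b1 a2 b2 h1 h2.
by apply: C => i; [apply: la|apply: lb].
Qed.

Lemma commutator_mono alpha alpha' beta beta' :
  alpha' <= alpha -> beta' <= beta ->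
  commutator alpha' beta' <= commutator alpha beta.
Proof.
move=> la lb; apply: commutator_least.
exact: term_condition_mono la lb (@commutator_term_condition _ _ _ _).
Qed.

Lemma lower_centralE n : lower_central A n = iter n (commutator \top) \top.
Proof. by elim: n => //= n ->. Qed.

Lemma iter_commutator_le n k alpha : (n <= k)%N ->
  iter k (commutator \top) alpha <= iter n (commutator \top) alpha.
Proof.
move=> /subnK<-; elim: (k - n)%N => //= j; apply: le_trans.
exact: commutator_ler.
Qed.

End Commutator.

Section Malcev.
Variables (S : signature) (A : finalgebra S) (d : term S 'I_3).
Implicit Types alpha beta gamma eta : con A.
Hypothesis dP : forall x y : A,
  eval (tnth [tuple x; x; y]) d = y /\ eval (tnth [tuple y; x; x]) d = y.

Let mal (x y z : A) : A := eval (tnth [tuple x; y; z]) d.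

Let malL x y : mal x x y = y. Proof. by case: (dP x y). Qed.
Let malR x y : mal y x x = y. Proof. by case: (dP x y). Qed.

Let mal_con alpha x x' y y' z z' :
  alpha x x' -> alpha y y' -> alpha z z' -> alpha (mal x y z) (mal x' y' z').
Proof. by move=> hx hy hz; apply: con_eval => -[[|[|[|]]]]. Qed.

(** d(x, y, z) is congruent to d(x, y, y) = x modulo beta and to
    d(y, y, z) = z modulo alpha. *)
Lemma con_permute alpha beta x y z : alpha x y -> beta y z ->
  exists2 w, beta x w & alpha w z.
Proof.
move=> xy yz; exists (mal x y z).
  by rewrite -{1}(malR y x); apply: mal_con; rewrite ?con_refl.
by rewrite -{2}(malL y z); apply: mal_con; rewrite ?con_refl.
Qed.

(** Permutability makes the relational product of two congruences a
    congruence. *)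
Lemma comp_subproof alpha beta :
  congruence (fun x y : A => [exists z, alpha x z && beta z y]).
Proof.
split=> [x|x y|y x z|f a b ab].
- by apply/existsP; exists x; rewrite !con_refl.
- have sym u v : [exists z, alpha u z && beta z v] ->
      [exists z, alpha v z && beta z u].
    case/existsP => z /andP[uz zv].
    have [w h1 h2] := con_permute (con_sym zv) (con_sym uz).
    by apply/existsP; exists w; rewrite h1.
  by apply/idP/idP; apply: sym.
- case/existsP => u /andP[xu uy] /existsP[v /andP[yv vz]].
  have [w uw wv] := con_permute uy yv.
  by apply/existsP; exists w; rewrite (con_trans xu uw) (con_trans wv vz).
- pose c := [ffun i => xchoose (existsP (ab i))].
  have cP i : alpha (a i) (c i) && beta (c i) (b i).
    by rewrite ffunE; exact: (xchooseP (existsP (ab i))).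
  apply/existsP; exists (op A f c).
  by apply/andP; split; apply: con_op => i; case/andP: (cP i).
Qed.

Lemma con_joinP alpha beta x y :
  (alpha `|` beta : con A) x y -> exists2 z, alpha x z & beta z y.
Proof.
have: alpha `|` beta <= con_of (comp_subproof alpha beta).
  rewrite leUx; apply/andP; split; apply/con_le_relP => u v uv;
    rewrite con_ofE; apply/existsP; [exists v|exists u];
    by rewrite con_refl ?andbT.
move=> /con_le_relP h /h; rewrite con_ofE => /existsP[z /andP[h1 h2]].
by exists z.
Qed.

(** The given condition is applied to d(f(x, y), f(x, a2), f(b1, a2)), moving y
    from a2 to b2. At y = a2 the value is f(b1, a2) whatever x is, so at y = b2
    the values at x = a1 and at x = b1 are related modulo eta. The latter is
    f(b1, b2), and the former is related to f(b1, a2) because f(a1, a2) and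
    f(a1, b2) are related by assumption. *)
Lemma term_condition_sym alpha beta eta :
  term_condition alpha beta eta -> term_condition beta alpha eta.
Proof.
move=> C m n f a1 b1 a2 b2 h1 h2 h.
(* The condition for (alpha, beta) expects the block y first, whereas f has it
   second. *)
pose sw (z : 'I_m + 'I_n) : 'I_n + 'I_m + A :=
  match z with inl i => inl (inr i) | inr j => inl (inl j) end.
pose swl (z : 'I_m + 'I_n) : 'I_n + 'I_m + A :=
  match z with inl i => inl (inr i) | inr j => inr (a2 j) end.
pose swc (z : 'I_m + 'I_n) : 'I_n + 'I_m + A := inr (join_blocks b1 a2 z).
pose F (s : 'I_m + 'I_n -> 'I_n + 'I_m + A) v :=
  peval (fun z => match s z with inl y => v y | inr c => c end) f : A.
have pF s : polyop (F s) by apply: (@polyop_fix _ _ _ _ s (fun v => peval v f)); exists f.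
have pG : polyop (fun v => mal (F sw v) (F swl v) (F swc v)) by apply: polyop_term.
have FE u v : F sw (join_blocks u v) = peval (join_blocks v u) f.
  by congr (peval _ f); apply: funext => -[].
have FlE u v : F swl (join_blocks u v) = peval (join_blocks v a2) f.
  by congr (peval _ f); apply: funext => -[].
have FcE v : F swc v = peval (join_blocks b1 a2) f by [].
have := term_condition_polyop C pG h2 h1; rewrite !FE !FlE !FcE !malL malR.
move/(_ (con_refl _ _)); apply: con_trans.
set e := peval (join_blocks b1 a2) f.
rewrite -{1}(malL (peval (join_blocks a1 a2) f) e).
by apply: mal_con; rewrite ?con_refl.
Qed.

(** The condition passes to larger eta: applied to
    d(f(x1, x2), f(a1, x2), f(a1, a2)), whose value at x1 = a1 is constant, it
    relates f(b1, a2) to d(f(b1, b2), f(a1, b2), f(a1, a2)) modulo the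
    commutator, and the assumption f(a1, a2) = f(a1, b2) modulo eta collapses
    the latter to f(b1, b2). *)
Lemma term_condition_le alpha beta eta :
  commutator alpha beta <= eta -> term_condition alpha beta eta.
Proof.
move=> /con_le_relP le m n f a1 b1 a2 b2 h1 h2 h.
pose fl (z : 'I_m + 'I_n) : 'I_m + 'I_n + A :=
  match z with inl i => inr (a1 i) | inr j => inl (inr j) end.
pose fc (z : 'I_m + 'I_n) : 'I_m + 'I_n + A := inr (join_blocks a1 a2 z).
pose F (s : 'I_m + 'I_n -> 'I_m + 'I_n + A) v :=
  peval (fun z => match s z with inl y => v y | inr c => c end) f : A.
have pF s : polyop (F s) by apply: (@polyop_fix _ _ _ _ s (fun v => peval v f)); exists f.
have pG : polyop (fun v => mal (F inl v) (F fl v) (F fc v)) by apply: polyop_term.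
have FE v : F inl v = peval v f by [].
have FlE u v : F fl (join_blocks u v) = peval (join_blocks a1 v) f.
  by congr (peval _ f); apply: funext => -[].
have FcE v : F fc v = peval (join_blocks a1 a2) f by [].
have := term_condition_polyop (@commutator_term_condition _ _ alpha beta) pG h1 h2.
rewrite !FE !FlE !FcE !malL !malR => /(_ (con_refl _ _)) /le h3.
apply: con_trans h3 _.
rewrite -{2}(malR (peval (join_blocks a1 b2) f) (peval (join_blocks b1 b2) f)).
by apply: mal_con; rewrite ?con_refl.
Qed.

Lemma commutatorC alpha beta : commutator alpha beta = commutator beta alpha.
Proof.
by apply: le_anti; apply/andP; split; apply: commutator_least;
  apply: term_condition_sym; apply: commutator_term_condition.
Qed.

(** A pair in a join factors through an intermediate point, and the term
    condition can be applied along the two steps in turn. *)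
Lemma commutatorUl alpha beta gamma :
  commutator (alpha `|` beta) gamma
    = commutator alpha gamma `|` commutator beta gamma.
Proof.
apply: le_anti; apply/andP; split; last first.
  by rewrite leUx !commutator_mono // ?leUl ?leUr.
apply: commutator_least => m n f a1 b1 a2 b2 h1 h2 h.
have hc i : exists z, alpha (a1 i) z && beta z (b1 i).
  by have [z ? ?] := con_joinP (h1 i); exists z; apply/andP.
pose c i := xchoose (hc i).
have cP i : alpha (a1 i) (c i) && beta (c i) (b1 i) := xchooseP (hc i).
have Ca := term_condition_le (leUl (commutator alpha gamma) (commutator beta gamma)).
have Cb := term_condition_le (leUr (commutator beta gamma) (commutator alpha gamma)).
apply: (Cb _ _ _ c) => // [i|]; first by case/andP: (cP i).
by apply: (Ca _ _ _ a1) => // i; case/andP: (cP i).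
Qed.

Lemma commutatorUr alpha beta gamma :
  commutator alpha (beta `|` gamma)
    = commutator alpha beta `|` commutator alpha gamma.
Proof. by rewrite !(commutatorC alpha) commutatorUl. Qed.

(** * Non-nilpotency produces splitting pairs *)

Lemma iter_commutatorU n alpha beta :
  iter n (commutator \top) (alpha `|` beta)
    = iter n (commutator \top) alpha `|` iter n (commutator \top) beta.
Proof. by elim: n => //= n ->; rewrite commutatorUr. Qed.

(** Here epsilon is minimal among the congruences whose iterated commutators
    with the top never fall below rho, and delta is the join of everything not
    above epsilon. That epsilon is not below rho makes rho \/ epsilon strictly
    larger than rho, which is the progress made by the decomposition below. *)
Lemma nonnilpotent_splitting_pair rho :
  (forall n, ~~ (lower_central A n <= rho)) ->
  exists delta epsilon, splitting_pair delta epsilon /\ ~~ (epsilon <= rho).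
Proof.
move=> nonnil.
pose N alpha := exists n, iter n (commutator \top) alpha <= rho.
have NU alpha beta : N alpha -> N beta -> N (alpha `|` beta).
  move=> [n hn] [k hk]; exists (maxn n k); rewrite iter_commutatorU leUx.
  rewrite (le_trans (iter_commutator_le _ (leq_maxl n k)) hn).
  by rewrite (le_trans (iter_commutator_le _ (leq_maxr n k)) hk).
have Ntop : `[< ~ N \top >].
  by apply/asboolP => -[n]; rewrite -lower_centralE; apply/negP.
have [eps /asboolP Neps min_eps] :=
  @arg_minnP _ \top (fun alpha => `[< ~ N alpha >])
    (fun alpha : con A => #|con_set alpha|) Ntop.
have Nlt alpha : alpha < eps -> N alpha.
  move=> lt; have [//|nN] := pselect (N alpha).
  by have := min_eps alpha; rewrite leqNgt con_lt_card // => /(_ (asboolT nN)).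
have irr alpha beta : alpha < eps -> beta < eps -> alpha `|` beta < eps.
  move=> la lb; rewrite lt_neqAle leUx (ltW la) (ltW lb) !andbT.
  apply/eqP => e; apply: Neps; rewrite -e.
  by apply: NU; apply: Nlt.
have Geps : commutator \top eps = eps.
  have := commutator_ler \top eps; rewrite le_eqVlt => /orP[/eqP//|lt].
  by have [n hn] := Nlt _ lt; case: Neps; exists n.+1; rewrite iterSr.
have eps_rho : ~~ (eps <= rho) by apply/negP => le; apply: Neps; exists 0.
have eps0 : \bot < eps.
  by rewrite lt0x; apply: contraNneq eps_rho => ->; apply: le0x.
(* Join irreducibility of epsilon lets the strict inequality survive the join
   defining delta. *)
pose delta := \join_(alpha : con A | ~~ (eps <= alpha)) alpha.
have delta_eps : commutator delta eps < eps.
  rewrite /delta; elim/big_ind: _ => [|alpha beta|alpha le].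
  - exact: le_lt_trans (commutator_lel _ _) eps0.
  - by rewrite commutatorUl; apply: irr.
  rewrite lt_neqAle commutator_ler andbT; apply: contraNneq le => {1}<-.
  exact: commutator_lel.
exists delta, eps; split=> //; split=> //.
  rewrite ltx1; apply: contraTneq delta_eps => ->.
  by rewrite Geps ltxx.
move=> alpha; case: (boolP (eps <= alpha)) => [|le]; [by left|right].
exact: joins_sup.
Qed.

(** * Decomposition by coatoms *)

(** For beta below delta this is an instance of the modular law, obtained here
    from permutability. *)
Lemma splitting_distr beta delta epsilon x y :
  delta `&` epsilon = \bot -> (epsilon <= beta \/ beta <= delta) ->
  (beta `|` epsilon : con A) x y -> (beta `|` delta : con A) x y -> beta x y.
Proof.
move=> bot [/join_l -> //|le /con_joinP[z xz zy]]; rewrite (join_r le) => xy.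
have zy' := con_trans (con_sym (con_le_relP _ _ le _ _ xz)) xy.
suff /eqP<- : z == y by [].
by rewrite -con_botE -bot con_meetE zy'.
Qed.

(** Induction on the number of pairs outside rho. The splitting pair obtained
    from rho belongs to the whole congruence lattice, so the absence of strong
    splitting applies to it directly. The last two clauses
    are what a skew-free direct decomposition of the quotient by rho needs: the
    components recover every congruence above rho, and arbitrary residues can be
    prescribed. *)
Lemma coatom_decomposition rho : ~ splits_strongly (con A) ->
  exists (tau : con A) (s : seq (con A)),
  [/\ rho <= tau,
      exists n, lower_central A n <= tau,
      forall theta, theta \in s ->
        [/\ rho <= theta, theta < \top
          & forall alpha, theta < alpha -> alpha = \top],
      forall beta x y, rho <= beta -> (beta `|` tau : con A) x y ->
        (forall theta, theta \in s -> (beta `|` theta : con A) x y) ->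
        beta x y
    & forall (c : A) (a : nat -> A), exists2 x, tau x c &
        forall i, (i < size s)%N -> (nth \top s i) x (a i)].
Proof.
move=> nss; move: {2}#|~: con_set rho|.+1 (ltnSn #|~: con_set rho|) => k.
elim: k rho => // k IH rho; rewrite ltnS => rho_k.
have [nil|nnil] := pselect (exists n, lower_central A n <= rho).
  exists rho, [::]; split=> // [beta x y /join_l-> //|c a].
  by exists c => //; apply: con_refl.
have [|delta [eps [sp eps_rho]]] := @nonnilpotent_splitting_pair rho.
  by move=> n; apply/negP => le; apply: nnil; exists n.
have [bot top coatom] := not_splits_strongly_complements nss sp.
case: sp => delta1 eps0 sp.
have rho_delta : rho <= delta by case: (sp rho) => // h; rewrite h in eps_rho.
have lt : rho < rho `|` eps.
  rewrite lt_neqAle leUl andbT; apply: contraNneq eps_rho => ->; exact: leUr.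
have [|tau [s [rho_tau nil sP dist crt]]] := IH (rho `|` eps).
  apply: leq_trans rho_k; apply: proper_card.
  rewrite properEneq setCS; apply/andP; split; last exact: ltW lt.
  by apply: contraTneq lt => /setC_inj/val_inj->; rewrite ltxx.
move: (rho_tau); rewrite leUx => /andP[rho_tau' eps_tau].
exists tau, (delta :: s); split=> //.
- move=> theta; rewrite inE => /predU1P[->//|/sP[]].
  by rewrite leUx => /andP[].
- move=> beta x y rho_beta xy xys; apply: (splitting_distr bot (sp beta)).
    apply: dist; first by rewrite leUx lexUl // leUr.
      by rewrite -joinA (join_r eps_tau).
    move=> theta ths; case: (sP _ ths); rewrite leUx => /andP[_ le] _ _.
    by rewrite -joinA (join_r le); apply: xys; rewrite inE ths orbT.
  by apply: xys; rewrite inE eqxx.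
- move=> c a; have [y yc ya] := crt c (fun i => a i.+1).
  have: (delta `|` eps : con A) (a 0) y by rewrite top con_topE.
  case/con_joinP => x ax xy; exists x.
    by apply: con_trans yc; apply: (con_le_relP _ _ eps_tau).
  move=> [_|i]; first exact: con_sym.
  rewrite /= ltnS => lti; apply: con_trans (ya i lti).
  case: (sP _ (mem_nth \top lti)); rewrite leUx => /andP[_ le] _ _.
  exact: (con_le_relP _ _ le).
Qed.

(** * Nilpotency of quotients *)

(** The lower central series of the quotient is bounded by the image of
    the lower central series of A joined with tau, because
    [1, gamma \/ tau] <= [1, gamma] \/ tau. *)
Lemma quot_nilpotent tau n : lower_central A n <= tau -> nilpotent (quot tau).
Proof.
move=> le.
have step k : exists2 eta : con (quot tau), lower_central (quot tau) k <= eta &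
    forall x y, eta (proj tau x) (proj tau y)
      = (lower_central A k `|` tau : con A) x y.
  elim: k => [|k [eta le_eta etaE]].
    exists \top => // x y; rewrite con_topE; apply/esym.
    by rewrite join1x con_topE.
  have le_t : tau <= lower_central A k.+1 `|` tau by apply: leUr.
  exists (quot_con le_t); last exact: quot_con_proj.
  suff C : term_condition \top eta (quot_con le_t).
    apply: le_trans (commutator_mono (lexx _) le_eta) _.
    exact: commutator_least C.
  move=> m j f a1 b1 a2 b2 _ h2.
  (* A polynomial of the quotient lifts to A by choosing representatives of its
     constants and of its arguments. *)
  have lift (v : 'I_m + 'I_j -> quot tau) :
      peval v f = proj tau (peval (fun z => rep (v z)) (subst (fun z =>
        match z with inl x => Var S (inl x) | inr c => Var S (inr (rep c)) end)
        f)).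
    rewrite /peval eval_subst -(eval_hom (@proj_hom _ _ tau)).
    by apply: eq_eval => -[x|c] /=; rewrite proj_rep.
  have valE p q (a : 'I_p -> quot tau) (b : 'I_q -> quot tau) :
      (fun z => rep (join_blocks a b z))
        = join_blocks (fun i => rep (a i)) (fun i => rep (b i)).
    by apply: funext => -[].
  rewrite !lift !quot_con_proj !valE.
  have C : term_condition \top (lower_central A k `|` tau)
                          (lower_central A k.+1 `|` tau).
    by apply: term_condition_le; rewrite commutatorUr leU2 // commutator_ler.
  apply: C => i; first exact: con_topE.
  by rewrite -etaE !proj_rep.
have [eta /con_le_relP le_eta etaE] := step n.
exists n; apply: con_ext => u v; split=> [/le_eta|]; last first.
  by rewrite con_botE => /eqP->; apply: con_refl.
rewrite -(proj_rep u) -(proj_rep v) etaE (join_r le) con_botE.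
by move/proj_eqP => ->.
Qed.

End Malcev.

(** * Skew-free products of quotients *)

Section SkewFreeProduct.
Variables (S : signature) (A : finalgebra S) (m : nat) (Theta : 'I_m -> con A).

Hypothesis crt : forall a : 'I_m -> A, exists x, forall i, Theta i x (a i).
Hypothesis distr : forall (beta : con A) x y,
  (forall i, (beta `|` Theta i : con A) x y) -> beta x y.

Let D i := quot (Theta i).

Definition diag (x : A) : dprod D :=
  (finfun (fun i => proj (Theta i) x : D i) : {dffun forall i, D i}).

Lemma diagE x i : (diag x : {dffun forall i, D i}) i = proj (Theta i) x.
Proof. by rewrite /diag ffunE. Qed.

Lemma diag_hom f a : diag (op A f a) = op (dprod D) f [ffun i => diag (a i)].
Proof.
apply/ffunP => i; rewrite diagE /= ffunE proj_hom; congr (op (D i) f _).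
by apply/ffunP => k; rewrite !ffunE.
Qed.

Lemma diag_surj (b : dprod D) : exists x, b = diag x.
Proof.
have [x xP] := crt (fun i => rep ((b : {dffun forall i, D i}) i)).
exists x; apply/ffunP => i; rewrite diagE -[LHS]proj_rep.
by apply/proj_eqP/con_sym/xP.
Qed.

Lemma diag_inj : injective diag.
Proof.
move=> x y e; apply/eqP; rewrite -con_botE; apply: distr => i; rewrite join0x.
by apply/proj_eqP; rewrite -!diagE e.
Qed.

Lemma diag_isomorphic : isomorphic A (dprod D).
Proof.
exists diag; last exact: diag_hom.
have ex b : exists x, diag x == b by have [x ->] := diag_surj b; exists x.
exists (fun b => xchoose (ex b)) => [x|b]; last exact/eqP/(xchooseP (ex b)).
by apply: diag_inj; apply/eqP/(xchooseP (ex (diag x))).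
Qed.

(** A congruence of the product pulls back to a congruence beta' of A, and its
    components are the images of beta' joined with Theta i; as beta' is the
    meet of these joins, the components determine it. *)
Lemma quots_skew_free : skew_free D.
Proof.
move=> beta; pose beta' := pullback diag_hom beta.
exists (fun i => quot_con (leUr (Theta i) beta')) => a b.
have [x ->] := diag_surj a; have [y ->] := diag_surj b.
rewrite -(pullbackE diag_hom); split=> [xy i|h].
  rewrite !diagE quot_con_proj.
  exact: (con_le_relP _ _ (leUl beta' (Theta i))).
by apply: distr => i; have := h i; rewrite !diagE quot_con_proj.
Qed.

End SkewFreeProduct.

Theorem corollary4p4 (S : signature) (A : finalgebra S)
    (malcevA : has_malcev_term A) :
  (~ nilpotent A -> splits (con A)) /\
  (~ splits_strongly (con A) ->
   exists (n : nat) (B : finalgebra S) (C : 'I_n -> finalgebra S),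
     [/\ isomorphic A (dprod (cons_family B C)),
         nilpotent B,
         forall i : 'I_n, simple (C i)
       & skew_free (cons_family B C)]).
Proof.
case: malcevA => d dP; split=> [nnil|nss].
  have [|delta [eps [sp _]]] := nonnilpotent_splitting_pair dP (rho := \bot).
    by move=> n; rewrite lex0; apply/eqP => e; apply: nnil; exists n.
  by exists delta, eps.
have [tau [s [_ [n nil] sP dist crt]]] := coatom_decomposition dP \bot nss.
pose T := tnth (in_tuple s).
pose Theta := cons_family tau T.
exists (size s), (quot tau), (fun i => quot (T i)).
(* Both families have the same members, but not definitionally, as the case
   distinction on the index sits in different places. *)
have -> : cons_family (quot tau) (fun i => quot (T i)) = fun i => quot (Theta i).
  by apply: funext => i; rewrite /Theta /cons_family; case: unlift.
have Theta0 : Theta ord0 = tau by rewrite /Theta /cons_family unlift_none.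
have ThetaS i : Theta (lift ord0 i) = T i by rewrite /Theta /cons_family liftK.
have crt' (a : 'I_(size s).+1 -> A) : exists x, forall i, Theta i x (a i).
  have [x xt xs] := crt (a ord0) (fun i => a (inord i.+1)); exists x => i.
  case: (unliftP ord0 i) => [j ->|->]; last by rewrite Theta0.
  rewrite ThetaS /T (tnth_nth \top) /=.
  suff -> : lift ord0 j = inord j.+1 by apply: xs.
  by apply: val_inj; rewrite /= inordK // ltnS.
have distr (beta : con A) x y :
    (forall i, (beta `|` Theta i : con A) x y) -> beta x y.
  move=> h; apply: dist; [exact: le0x|by rewrite -Theta0|].
  move=> theta /(@nthP _ _ _ \top)[i lti <-].
  have := h (lift ord0 (Ordinal lti)).
  by rewrite ThetaS /T (tnth_nth \top).
split; [exact: diag_isomorphic crt' distr|exact: quot_nilpotent dP _ _ nil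
  | |exact: quots_skew_free crt' distr].
move=> i; have [_ lt1 co] := sP _ (mem_tnth i (in_tuple s)).
exact: quot_simple.
Qed.
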